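(* Let $G$ be a graph of order $n$ with minimum degree $\delta$, and suppose that $G$ has a perfect matching (in the sense that, if $n$ is odd, the matching is allowed to miss exactly one vertex). Let $\epsilon=0$ if $n$ is even and $\epsilon=1$ if $n$ is odd. Then $$ \gamma_r(G)\le\frac{\ln(\delta+1)+1}{\delta+1}\,2n+\epsilon, $$ and, provided $\delta>0$, $$ \gamma_{\mathrm{tr}}(G)\le\frac{\ln\delta+1}{\delta}\,2n+\epsilon . $$
   Context: All graphs are finite and undirected, without loops or multiple edges. A matching is a set of pairwise non-adjacent edges; here a matching is called perfect if it contains all vertices of the graph when $n$ is even, or all vertices but one when $n$ is odd. A set $X\subseteq V(G)$ is a dominating set of $G$ if every vertex not in $X$ is adjacent to a vertex in $X$. A dominating set $X$ is a restrained dominating set if every vertex in $V(G)-X$ is adjacent to a vertex in $V(G)-X$; $\gamma_r(G)$ is the minimum cardinality of a restrained dominating set. A restrained dominating set $X$ is a total restrained dominating set if, in addition, every vertex of $X$ is adjacent to a vertex of $X$; $\gamma_{\mathrm{tr}}(G)$ is the minimum cardinality of a total restrained dominating set. *)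

(* Defs.v *)
(* A simple graph on a finite vertex type T is a
   symmetric, irreflexive adjacency relation e : rel T. *)
From mathcomp Require Import all_boot all_order all_algebra.
From mathcomp Require Import reals exp.

Set Implicit Arguments.
Unset Strict Implicit.
Unset Printing Implicit Defensive.

Definition degree (T : finType) (e : rel T) (v : T) : nat := #|[set w | e v w]|.

(* The default #|T| bounds every degree, so it does not affect the minimum when
   T is inhabited; the graph without vertices gets minimum degree 0. *)
Definition min_degree (T : finType) (e : rel T) : nat :=
  \big[minn/#|T|]_(v : T) degree e v.

Definition edges (T : finType) (e : rel T) : {set {set T}} :=
  [set [set p.1; p.2] | p : T * T & e p.1 p.2].

Definition matching (T : finType) (e : rel T) (M : {set {set T}}) : bool :=
  (M \subset edges e) && trivIset M.

(* The number of missed vertices is 0 if #|T| is even and 1 if #|T| is odd. *)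
Definition perfect_matching (T : finType) (e : rel T) (M : {set {set T}}) :
    bool :=
  matching e M && (#|~: cover M| == odd #|T|).

Definition dominating (T : finType) (e : rel T) (X : {set T}) : bool :=
  [forall v, (v \notin X) ==> [exists w, (w \in X) && e v w]].

Definition restrained_dominating (T : finType) (e : rel T) (X : {set T}) :
    bool :=
  dominating e X &&
  [forall v, (v \notin X) ==> [exists w, (w \notin X) && e v w]].

Definition total_restrained_dominating (T : finType) (e : rel T)
    (X : {set T}) : bool :=
  restrained_dominating e X &&
  [forall v, (v \in X) ==> [exists w, (w \in X) && e v w]].

(* [set: T] is always restrained dominating, and it is total restrained
   dominating when no vertex is isolated; gamma_tr is only meaningful then. *)
Definition gamma_r (T : finType) (e : rel T) : nat :=
  #|[arg min_(X < [set: T] | restrained_dominating e X) #|X|]|.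

Definition gamma_tr (T : finType) (e : rel T) : nat :=
  #|[arg min_(X < [set: T] | total_restrained_dominating e X) #|X|]|.

Lemma restrained_dominatingT (T : finType) (e : rel T) :
  restrained_dominating e [set: T].
Proof. by apply/andP; split; apply/forallP => v; rewrite inE. Qed.

Lemma min_degree_le (T : finType) (e : rel T) (v : T) :
  min_degree e <= degree e v.
Proof.
rewrite /min_degree; elim: index_enum (mem_index_enum v) => // w s IHs.
rewrite big_cons inE geq_min => /predU1P[->|/IHs ->]; first by rewrite leqnn.
by rewrite orbT.
Qed.

Lemma min_degree_attained (T : finType) (e : rel T) :
  0 < #|T| -> exists v, degree e v = min_degree e.
Proof.
case/card_gt0P => v0 _.
have [v _ hv] := @arg_minnP T v0 predT (degree e) isT.
exists v; apply/eqP; rewrite eqn_leq min_degree_le andbT /min_degree.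
elim/big_ind: _ => [|m n hm hn|w _]; first exact: max_card.
  by rewrite leq_min hm hn.
exact: hv.
Qed.

Lemma total_restrained_dominatingT (T : finType) (e : rel T) :
  0 < min_degree e -> total_restrained_dominating e [set: T].
Proof.
move=> d_gt0; rewrite /total_restrained_dominating restrained_dominatingT /=.
apply/forallP => v; rewrite inE /=.
have /card_gt0P[w] := leq_trans d_gt0 (min_degree_le e v).
by rewrite inE => evw; apply/existsP; exists w; rewrite inE.
Qed.

Lemma gamma_rP (T : finType) (e : rel T) :
  (exists2 X, restrained_dominating e X & #|X| = gamma_r e) /\
  (forall X, restrained_dominating e X -> gamma_r e <= #|X|).
Proof.
rewrite /gamma_r; case: arg_minnP => [|X hX minX].
  exact: restrained_dominatingT.
by split=> //; exists X.
Qed.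

Lemma gamma_trP (T : finType) (e : rel T) : 0 < min_degree e ->
  (exists2 X, total_restrained_dominating e X & #|X| = gamma_tr e) /\
  (forall X, total_restrained_dominating e X -> gamma_tr e <= #|X|).
Proof.
move=> d_gt0; rewrite /gamma_tr; case: arg_minnP => [|X hX minX].
  exact: total_restrained_dominatingT.
by split=> //; exists X.
Qed.

(* Main.v *)
(** Put each vertex in a random set independently with probability
    [p = ln k / k], where every vertex has at least [k] (open or closed)
    neighbours, and add one neighbour of every vertex left undominated: the
    expected size is at most [n p + n (1 - p)^k <= n (ln k + 1) / k].  Closing
    such a dominating set under the matching, and adding the unmatched vertex
    if there is one, at most doubles its size plus [epsilon]; the complement is
    then a union of matching edges, so the closure is restrained. *)
Require Import Defs.
From mathcomp Require Import all_boot all_order all_algebra.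
From mathcomp Require Import reals sequences exp.
Import Order.TTheory GRing.Theory Num.Theory.
Local Open Scope ring_scope.

Section RandomSubset.
Variables (R : realType) (T : finType) (p : R).

(** [p] is any real here: the sums computed below are polynomial identities, and [0 <= p <= 1]
    serves only for signs. *)
Definition bernoulli_weight (X : {set T}) : R :=
  \prod_i (if i \in X then p else 1 - p).

Lemma bernoulli_weight_ge0 (X : {set T}) :
  0 <= p <= 1 -> 0 <= bernoulli_weight X.
Proof.
move=> /andP[p_ge0 p_le1]; apply: prodr_ge0 => i _.
by case: ifP => _ //; rewrite subr_ge0.
Qed.

Lemma sum_bernoulli_weight : \sum_(X : {set T}) bernoulli_weight X = 1.
Proof. by rewrite -bigA_distr big1 // => i _ /=; rewrite subrKC. Qed.

(** Expand a product of sums into one term per subset; replacing [1 - p] by 0 in the factor at [v]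
    kills exactly the subsets that avoid [v]. *)
Lemma bernoulli_weight_mem (v : T) :
  \sum_(X : {set T} | v \in X) bernoulli_weight X = p.
Proof.
transitivity (\prod_(i : T) (p + (if i == v then 0 else 1 - p))).
  rewrite bigA_distr big_mkcond /=; apply: eq_bigr => X _.
  case: ifPn => [vX|vX].
    apply: eq_bigr => i _; case: ifPn => // iX.
    by case: eqP iX => // ->; rewrite vX.
  by rewrite (bigD1 v) //= (negPf vX) eqxx mul0r.
rewrite (bigD1 v) //= eqxx addr0 big1 ?mulr1 // => i /negPf->.
by rewrite subrKC.
Qed.

(** The same expansion with [p] replaced by 0 on [A], which kills the subsets meeting [A]. *)
Lemma bernoulli_weight_disjoint (A : {set T}) :
  \sum_(X : {set T} | [disjoint A & X]) bernoulli_weight X = (1 - p) ^+ #|A|.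
Proof.
transitivity (\prod_(i : T) ((if i \in A then 0 else p) + (1 - p))).
  rewrite bigA_distr big_mkcond /=; apply: eq_bigr => X _.
  case: ifPn => [dAX|/pred0Pn[v /andP[/= vA vX]]].
    apply: eq_bigr => i _; case: ifPn => // iX.
    by rewrite (disjointFl dAX iX).
  by rewrite (bigD1 v) //= vX vA mul0r.
rewrite (bigID (mem A)) /= mulrC big1 ?mul1r => [|i /negPf->].
  by rewrite -prodr_const; apply: eq_bigr => i ->; rewrite add0r.
by rewrite subrKC.
Qed.

Lemma exists_le_mean (f : {set T} -> R) (c : R) : 0 <= p <= 1 ->
  \sum_X bernoulli_weight X * f X <= c -> exists X, f X <= c.
Proof.
move=> p01 mean_le.
apply/existsP; apply: contraLR mean_le => /existsPn f_gt; rewrite -ltNge.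
(* A strict inequality between means needs one set of positive weight; it exists because the weights
   sum to 1. *)
have [X w_gt0] : exists X, 0 < bernoulli_weight X.
  apply/existsP; apply: contraT => /existsPn w_le0.
  have := ltr01 (R := R); rewrite -sum_bernoulli_weight ltNge.
  by rewrite sumr_le0 // => X _; rewrite leNgt.
rewrite -[ltLHS]mul1r -sum_bernoulli_weight mulr_suml.
rewrite (bigD1 X) //= [ltRHS](bigD1 X) //=; apply: ltr_leD.
  by rewrite ltr_pM2l // ltNge.
apply: ler_sum => Y _; apply: ler_wpM2l; first exact: bernoulli_weight_ge0.
by rewrite ltW // ltNge.
Qed.

End RandomSubset.

(** Keeping [N] abstract covers closed neighbourhoods, for [gamma_r], and open ones, for
    [gamma_tr]. *)
Lemma small_hitting_set (R : realType) (T : finType) (N : T -> {set T})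
    (k : nat) : (0 < k)%N -> (forall v, (k <= #|N v|)%N) ->
  exists2 X : {set T}, forall v, exists2 w, w \in X & w \in N v
    & #|X|%:R <= (ln k%:R + 1) / k%:R * #|T|%:R :> R.
Proof.
move=> k_gt0 N_ge.
set p : R := ln k%:R / k%:R.
have kR_gt0 : 0 < k%:R :> R by rewrite ltr0n.
have p01 : 0 <= p <= 1.
  rewrite divr_ge0 ?ler0n ?ln_ge0 ?ler1n //= ler_pdivrMr // mul1r.
  by rewrite (le_trans (ltW (ln_sublinear kR_gt0))).
have /andP[p_ge0 p_le1] := p01.
have q_ge0 : 0 <= 1 - p by rewrite subr_ge0.
(* From [1 - p <= expR (- p)]; the choice of [p] makes the [k]-th power of the right side exactly
   [1 / k]. *)
have miss v : (1 - p) ^+ #|N v| <= k%:R^-1.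
  have -> : k%:R^-1 = expR (- p) ^+ k :> R.
    by rewrite -expRM_natl mulrN mulrC divfK ?gt_eqF // expRN lnK.
  apply: (@le_trans _ _ ((1 - p) ^+ k)).
    by apply: ler_wiXn2l; rewrite // lerBlDr lerDl.
  by rewrite lerXn2r ?nnegrE ?expR_ge0 // expR_ge1Dx.
pose unhit (X : {set T}) := [set v | [disjoint N v & X]].
pose cost (X : {set T}) : R := #|X|%:R + #|unhit X|%:R.
have mean_cost : \sum_(X : {set T}) bernoulli_weight R T p X * cost X
    <= (ln k%:R + 1) / k%:R * #|T|%:R.
  have card_sum (A : {set T}) : #|A|%:R = \sum_v (v \in A)%:R :> R.
    by rewrite -sum1_card natr_sum big_mkcond; apply: eq_bigr => v _; case: ifP.
  (* Linearity of expectation: the mean size of [P X] is the sum over [v] of the probability that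
     [v] lies in [P X]. *)
  have swap (P : {set T} -> {set T}) :
      \sum_X bernoulli_weight R T p X * #|P X|%:R
      = \sum_v \sum_(X | v \in P X) bernoulli_weight R T p X.
    under eq_bigr do rewrite card_sum mulr_sumr.
    rewrite exchange_big /=; apply: eq_bigr => v _.
    rewrite [RHS]big_mkcond; apply: eq_bigr => X _.
    by case: ifP; rewrite ?mulr1 ?mulr0.
  under eq_bigr do rewrite mulrDr.
  rewrite big_split /= (swap id) (swap unhit) mulrDl mul1r -/p.
  rewrite mulr_natr -sumr_const -big_split /=.
  apply: ler_sum => v _; rewrite bernoulli_weight_mem lerD2l.
  under eq_bigl do rewrite inE.
  by rewrite bernoulli_weight_disjoint.
have [X X_cost] : exists X, cost X <= (ln k%:R + 1) / k%:R * #|T|%:R.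
  by apply: exists_le_mean mean_cost.
have nbr v : exists w, w \in N v.
  by apply/card_gt0P; apply: leq_trans (N_ge v).
pose f v := xchoose (nbr v).
exists (X :|: f @: unhit X) => [v|].
  have [vU|] := boolP (v \in unhit X).
    by exists (f v); rewrite ?inE ?imset_f ?orbT //; apply: xchooseP.
  by rewrite inE => /pred0Pn[w /andP[/= wN wX]]; exists w; rewrite // inE wX.
apply: le_trans X_cost; rewrite /cost -natrD ler_nat.
by rewrite (leq_trans (leq_card_setU _ _)) // leq_add2l leq_imset_card.
Qed.

Section MatchingClosure.
Variables (T : finType) (e : rel T) (M : {set {set T}}).
Hypotheses (e_sym : symmetric e) (M_pm : perfect_matching e M).

(** [pblock M x] is the matching edge at [x], and is empty if [x] is unmatched; hence the separate
    term for unmatched vertices. *)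
Definition matching_closure (X : {set T}) : {set T} :=
  \bigcup_(x in X) pblock M x :|: ~: cover M.

Lemma sub_matching_closure (X : {set T}) : X \subset matching_closure X.
Proof.
apply/subsetP => x xX; rewrite !inE; have [xM|] := boolP (x \in cover M).
  by rewrite orbF; apply/bigcupP; exists x; rewrite ?mem_pblock.
by rewrite orbT.
Qed.

Lemma card_matching_closure (X : {set T}) :
  (#|matching_closure X| <= #|X| * 2 + odd #|T|)%N.
Proof.
have /andP[/andP[/subsetP M_edges _] /eqP cardC] := M_pm.
rewrite (leq_trans (leq_card_setU _ _)) // cardC leq_add2r -sum_nat_const.
elim/big_rec2: _ => [|x m A _ le_Am]; first by rewrite cards0.
rewrite (leq_trans (leq_card_setU _ _)) // leq_add //.
have [/pblock_mem/M_edges/imsetP[[a b] _ ->]|xM] := boolP (x \in cover M).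
  by rewrite cards2; case: (_ != _).
rewrite /pblock; case: pickP => [B /andP[BM xB]|_]; last by rewrite cards0.
by case/bigcupP: xM; exists B.
Qed.

Lemma matching_closure_restrained (X : {set T}) (v : T) :
  v \notin matching_closure X ->
  exists w, (w \notin matching_closure X) && e v w.
Proof.
have /andP[/andP[/subsetP M_edges trivM] _] := M_pm.
move=> vA.
have vM : v \in cover M by move: vA; rewrite !inE negb_or negbK => /andP[].
have BM := pblock_mem vM.
have [w wB evw] : exists2 w, w \in pblock M v & e v w.
  have /imsetP[[a b]] := M_edges _ BM; rewrite inE /= => eab defB.
  move: vM; rewrite -mem_pblock defB => /set2P[]->.
    by exists b; rewrite // set22.
  by exists a; rewrite ?set21 // e_sym.
(* The matching partner [w] of [v] works: a block that brings [w] into the closure is, by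
   disjointness, the block of [v]. *)
exists w; rewrite evw andbT; apply: contra vA; rewrite !inE.
have wM : w \in cover M by apply/bigcupP; exists (pblock M v).
rewrite wM orbF => /bigcupP[x xX wx]; apply/orP; left.
apply/bigcupP; exists x => //.
by rewrite -(same_pblock trivM wx) (same_pblock trivM wB) mem_pblock.
Qed.

Lemma restrained_dominating_closure (X : {set T}) :
  dominating e X -> restrained_dominating e (matching_closure X).
Proof.
move=> /forallP domX; apply/andP; split; apply/forallP => v; apply/implyP => vA.
  have vX : v \notin X.
    by apply: contra vA => /(subsetP (sub_matching_closure X)).
  have /existsP[w /andP[wX evw]] := implyP (domX v) vX.
  by apply/existsP; exists w; rewrite evw (subsetP (sub_matching_closure X)).
by apply/existsP; apply: matching_closure_restrained.
Qed.

Lemma total_restrained_dominating_closure (X : {set T}) :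
  (forall v, exists2 w, w \in X & e v w) ->
  total_restrained_dominating e (matching_closure X).
Proof.
move=> tdomX; apply/andP; split.
  apply: restrained_dominating_closure; apply/forallP => v; apply/implyP => _.
  by have [w wX evw] := tdomX v; apply/existsP; exists w; rewrite wX.
apply/forallP => v; apply/implyP => _; have [w wX evw] := tdomX v.
by apply/existsP; exists w; rewrite evw (subsetP (sub_matching_closure X)).
Qed.

End MatchingClosure.

Theorem corollary3 (R : realType) (T : finType) (e : rel T)
  (e_sym : symmetric e) (e_irr : irreflexive e)
  (n delta : nat) (n_def : n = #|T|) (delta_def : delta = min_degree e)
  (e_pm : exists M : {set {set T}}, perfect_matching e M) :
  (gamma_r e)%:R
    <= (ln (delta%:R + 1) + 1) / (delta%:R + 1) * (2 * n%:R)
       + (if odd n then 1 else 0) :> R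
  /\
  ((0 < delta)%N ->
   (gamma_tr e)%:R
     <= (ln delta%:R + 1) / delta%:R * (2 * n%:R)
        + (if odd n then 1 else 0) :> R).
Proof.
have [M M_pm] := e_pm; rewrite {}n_def.
have closure_bound (g : nat) (X : {set T}) (c : R) :
    (g <= #|matching_closure T M X|)%N -> #|X|%:R <= c * #|T|%:R ->
    g%:R <= c * (2 * #|T|%:R) + (if odd #|T| then 1 else 0).
  move=> g_le X_le.
  have -> : (if odd #|T| then 1 else 0) = (odd #|T|)%:R :> R by case: odd.
  have := leq_trans g_le (card_matching_closure T e M M_pm X).
  rewrite -(ler_nat R) natrD natrM => /le_trans; apply.
  by rewrite lerD2r [2 * _]mulrC mulrA ler_pM2r.
split=> [|delta_gt0].
  (* Closed neighbourhoods have at least [delta + 1] elements, as [v] is not its own neighbour. *)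
  have [v|X hitX X_le] :=
    small_hitting_set R T (fun v => v |: [set w | e v w]) delta.+1 isT.
    by rewrite cardsU1 inE e_irr ltnS delta_def min_degree_le.
  rewrite -natr1 in X_le; apply: (closure_bound _ X) X_le.
  have [_ gamma_r_le] := gamma_rP e.
  apply: gamma_r_le; apply: restrained_dominating_closure => //.
  apply/forallP => v; apply/implyP => vX; have [w wX] := hitX v.
  (* Since [v] is outside [X], the element hitting its closed neighbourhood is a true neighbour. *)
  rewrite !inE => /predU1P[wv|evw]; first by rewrite -wv wX in vX.
  by apply/existsP; exists w; rewrite wX.
(* Open neighbourhoods give every vertex, in [X] or not, a neighbour in [X], as totality demands. *)
have [v|X hitX X_le] :=
  small_hitting_set R T (fun v => [set w | e v w]) delta delta_gt0.
  by rewrite delta_def min_degree_le.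
apply: (closure_bound _ X) X_le; rewrite delta_def in delta_gt0.
have [_ gamma_tr_le] := gamma_trP delta_gt0.
apply: gamma_tr_le; apply: total_restrained_dominating_closure => //.
by move=> v; have [w wX] := hitX v; rewrite inE; exists w.
Qed.
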